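(* Let $G=(V,E)$ be a (finite or infinite) graph, and let $L=\{L_v:v\in V\}\cup\{L_e:e\in E\}$ be a set of lists of positive integers such that $|L_v|\geq 2$ for every vertex $v$ and $|L_e|\geq 3$ for every edge $e$. Then there exists an $L$-weighting of $G$.
   Context: Graphs are simple and may be infinite. Each list is a finite subset of $\{1,\dots,k\}$ for some natural number $k$. A weighting of $G$ from $L$ is a function $\omega\colon V\cup E\to\mathbb{Z}_{>0}$ with $\omega(v)\in L_v$ for all $v\in V$ and $\omega(e)\in L_e$ for all $e\in E$. The weighted degree of a vertex $v$ is $s_\omega(v)=\sum_{w\in N(v)}\omega(vw)+\omega(v)$; if $v$ has infinite degree $\kappa$ this sum is the cardinal $\kappa$ (equal to the degree of $v$). An $L$-weighting of $G$ is a weighting $\omega$ from $L$ such that for every edge $uv$ of $G$, either $s_\omega(u)\neq s_\omega(v)$, or $u$ and $v$ have the same infinite degree. *)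

(* Defs.v *)
From Stdlib Require Import List Arith.
Import ListNotations.

(* A simple graph on an arbitrary (possibly infinite) vertex type V is given by
   a symmetric irreflexive adjacency relation. Edge-indexed data are encoded as
   functions of two vertices that are symmetric on adjacent pairs. *)
Definition simple_graph {V : Type} (adj : V -> V -> Prop) : Prop :=
  (forall u v, adj u v -> adj v u) /\ (forall v, ~ adj v v).

Definition finite_degree {V : Type} (adj : V -> V -> Prop) (v : V) : Prop :=
  exists l : list V, NoDup l /\ forall w, adj v w <-> In w l.

Definition infinite_degree {V : Type} (adj : V -> V -> Prop) (v : V) : Prop :=
  ~ finite_degree adj v.

Definition same_degree {V : Type} (adj : V -> V -> Prop) (u v : V) : Prop :=
  exists (f : {w | adj u w} -> {w | adj v w}) (g : {w | adj v w} -> {w | adj u w}),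
    (forall x, g (f x) = x) /\ (forall y, f (g y) = y).

Definition wdeg_is {V : Type} (adj : V -> V -> Prop)
  (wv : V -> nat) (we : V -> V -> nat) (v : V) (n : nat) : Prop :=
  exists l : list V, NoDup l /\ (forall w, adj v w <-> In w l) /\
    n = wv v + fold_right (fun w acc => we v w + acc) 0 l.

(* s_w(u) = s_w(v): both finite with equal sums, or both infinite cardinals
   (equal to the degrees) that coincide. *)
Definition wdeg_eq {V : Type} (adj : V -> V -> Prop)
  (wv : V -> nat) (we : V -> V -> nat) (u v : V) : Prop :=
  (exists n, wdeg_is adj wv we u n /\ wdeg_is adj wv we v n) \/
  (infinite_degree adj u /\ infinite_degree adj v /\ same_degree adj u v).

Definition same_infinite_degree {V : Type} (adj : V -> V -> Prop) (u v : V) : Prop :=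
  infinite_degree adj u /\ infinite_degree adj v /\ same_degree adj u v.

Definition is_list (l : list nat) : Prop :=
  NoDup l /\ forall x, In x l -> 0 < x.

Definition weighting_from {V : Type} (adj : V -> V -> Prop)
  (Lv : V -> list nat) (Le : V -> V -> list nat)
  (wv : V -> nat) (we : V -> V -> nat) : Prop :=
  (forall v, In (wv v) (Lv v)) /\
  (forall u v, adj u v -> we u v = we v u) /\
  (forall u v, adj u v -> In (we u v) (Le u v)).

Definition L_weighting {V : Type} (adj : V -> V -> Prop)
  (Lv : V -> list nat) (Le : V -> V -> list nat)
  (wv : V -> nat) (we : V -> V -> nat) : Prop :=
  weighting_from adj Lv Le wv we /\
  forall u v, adj u v ->
    ~ wdeg_eq adj wv we u v \/ same_infinite_degree adj u v.

(* Main.v *)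
(* Finite graphs (Wong and Zhu). Let A have one row for each edge ab, holding the
   coefficients of the linear form s(a) - s(b) in the vertex and edge weights. By
   the combinatorial Nullstellensatz it suffices to find a square matrix of
   columns of A, with every vertex used at most once and every edge at most twice,
   whose permanent is nonzero. The column of an edge uv is the sum of the columns
   of u and v. Suppose such columns are known for G - v, and let u_1, .., u_k be
   the neighbours of v. Add k copies of the column v: as it vanishes on the old
   rows, the permanent is multiplied by k!. With one more copy of v the permanent
   would vanish, so each u_i among the old columns may be replaced by the edge
   v u_i = u_i + v. Finally write the i-th copy of v as v u_i - u_i and expand: some
   term is nonzero, and it uses each u_i at most once and each v u_i at most twice.

   Infinite graphs. Only edges between vertices of finite degree impose a
   condition, and each such condition involves finitely many weights. Take the
   limit, along an ultrafilter containing all sets {W | W0 <= W}, of weightings of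
   the finite induced subgraphs G[W]. *)
Require Import Defs.
From Stdlib Require Import List Arith.
From mathcomp Require Import all_boot all_order all_algebra.
From mathcomp Require Import boolp classical_sets filter.
Set Implicit Arguments. Unset Strict Implicit. Unset Printing Implicit Defensive.
Import GRing.Theory Num.Theory.
Local Open Scope ring_scope.

(** * Permanents with repeated columns *)

Section Permanent.
Variables (F : fieldType) (I : eqType) (Z : finType) (A : I -> Z -> F).

(* The permanent of the matrix with rows rs and columns cs, expanded along its
   first row; equal columns are grouped, so that cs matters only as a multiset. *)
Fixpoint per (rs : seq I) (cs : seq Z) : F :=
  if rs is r :: rs' then
    \sum_(z : Z) A r z * per rs' (rem z cs) *+ count_mem z cs
  else (cs == [::])%:R.

Lemma perm_eq_rem (z : Z) cs cs' :
  perm_eq cs cs' -> perm_eq (rem z cs) (rem z cs').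
Proof.
move=> e; have [zcs|zNcs] := boolP (z \in cs).
  rewrite -(perm_cons z) -(permPl (perm_to_rem zcs)).
  by rewrite -(permPr (perm_to_rem _)) // -(perm_mem e).
by rewrite !rem_id // -(perm_mem e).
Qed.

Lemma per_perm rs cs cs' : perm_eq cs cs' -> per rs cs = per rs cs'.
Proof.
elim: rs cs cs' => [|r rs IH] cs cs' e /=.
  by rewrite -!size_eq0 (perm_size e).
apply: eq_bigr => z _; rewrite (permP e) (IH _ (rem z cs')) //.
exact: perm_eq_rem.
Qed.

(** Row [r] takes either the displayed copy of [c] or a column of [cs]. *)
Lemma per_cons r rs c cs :
  per (r :: rs) (c :: cs) =
  A r c * per rs cs
  + \sum_(z : Z) A r z * per rs (c :: rem z cs) *+ count_mem z cs.
Proof.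
transitivity (\sum_z ((A r c * per rs cs) *+ (z == c) +
   A r z * per rs (c :: rem z cs) *+ count_mem z cs)); last first.
  rewrite big_split /= (bigD1 c) //= eqxx mulr1n big1 ?addr0 // => z zc.
  by rewrite (negPf zc) mulr0n.
rewrite /=; apply: eq_bigr => z _; rewrite [c == z]eq_sym.
have [->|zc] := eqVneq z c; last by rewrite add0n mulr0n add0r.
rewrite mulrnDr mulr1n; congr (_ + _).
have [ccs|/count_memPn -> //] := boolP (c \in cs).
by rewrite (per_perm _ (perm_to_rem ccs)).
Qed.

Lemma per_consD e u v rs cs : (forall r, A r e = A r u + A r v) ->
  per rs (e :: cs) = per rs (u :: cs) + per rs (v :: cs).
Proof.
move=> eE; elim: rs cs => [|r rs IH] cs; first by rewrite /= addr0.
rewrite !per_cons eE mulrDl addrACA; congr (_ + _).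
by rewrite -big_split; apply: eq_bigr => z _; rewrite IH mulrDr mulrnDl.
Qed.

(** Pigeonhole: each copy of [v] must be matched with its own row that is nonzero at [v]. *)
Lemma per_eq0 v rs cs :
  (count (fun r => A r v != 0%R) rs < count_mem v cs)%N -> per rs cs = 0.
Proof.
elim: rs cs => [|r rs IH] cs /=; first by case: cs.
move=> lt; apply: big1 => z _; have [->|zv] := eqVneq z v.
  have [->|nz] := eqVneq (A r v) 0; first by rewrite mul0r mul0rn.
  rewrite IH ?mulr0 ?mul0rn //.
  move: lt; rewrite nz add1n count_rem /= eqxx andbT.
  have [vcs|/count_memPn -> //] := boolP (v \in cs).
  by rewrite subn1 ltn_predRL.
rewrite IH ?mulr0 ?mul0rn // count_rem /= [z == v](negPf zv) andbF subn0.
exact: leq_ltn_trans (leq_addl _ _) lt.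
Qed.

(** Only the rows of [new] can take the copies of [v], in any order and with entry 1; the rows of
    [old] are left with [cs]. *)
Lemma per_block v new old cs :
  {in new, forall r, A r v = 1} -> {in old, forall r, A r v = 0} ->
  v \notin cs ->
  per (new ++ old) (nseq (size new) v ++ cs) = (size new)`!%:R * per old cs.
Proof.
move=> A1 A0 vcs; elim: new A1 => [|r new IH] A1; first by rewrite fact0 mul1r.
have A1' : {in new, forall r, A r v = 1} by move=> x xn; apply: A1; rewrite inE xn orbT.
have cnt : count (fun r => A r v != 0) (new ++ old) = size new.
  rewrite count_cat (@eq_in_count _ _ predT); last first.
    by move=> x /A1' ->; rewrite oner_eq0.
  rewrite count_predT (@eq_in_count _ _ pred0) ?count_pred0 ?addn0 //.
  by move=> x /A0 ->; rewrite eqxx.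
rewrite [size _]/= [nseq _ _]/= !cat_cons per_cons A1 ?mem_head // mul1r IH //.
(* Giving the first row another column would leave one copy of [v] too many for the rest of
   [new]. *)
rewrite (bigD1 v) //= big1 ?addr0 => [|z zv]; last first.
  rewrite (@per_eq0 v) ?mulr0 ?mul0rn //= cnt eqxx add1n ltnS.
  rewrite count_rem /= [z == v](negPf zv) andbF subn0 count_cat.
  by rewrite count_nseq /= eqxx mul1n leq_addr.
rewrite A1 ?mem_head // mul1r count_cat count_nseq /= eqxx mul1n (count_memPn vcs) addn0.
rewrite factS natrM mulrS mulrDl mul1r mulrDl; congr (_ + _).
case: (posnP (size new)) => [->|k_gt0]; first by rewrite mulr0n !mul0r.
rewrite (per_perm _ (_ : perm_eq _ (nseq (size new) v ++ cs))); last first.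
  rewrite perm_sym perm_to_rem // mem_cat mem_nseq k_gt0 eqxx //.
by rewrite IH // -mulr_natl mulrA.
Qed.

End Permanent.

(** * The combinatorial Nullstellensatz for products of linear forms *)

Lemma size_count_mem (Z : finType) (s : seq Z) :
  size s = (\sum_z count_mem z s)%N.
Proof.
elim: s => [|c s IH] /=; first by rewrite big1.
by rewrite big_split /= -IH (bigD1 c) //= eqxx big1 ?addn0 // => z /negPf;
   rewrite eq_sym => ->.
Qed.

(** These are the weights of the divided difference at the first [d.+1] points of [s]; the
    Vandermonde matrix of distinct points is invertible. *)
Lemma ex_moment_weights (F : fieldType) (s : seq F) (d : nat) : uniq s -> (d < size s)%N ->
  exists w : nat -> F, forall j, (j <= d)%N ->
    \sum_(i < d.+1) w i * s`_i ^+ j = (j == d)%:R.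
Proof.
move=> s_uniq ds; pose V := Vandermonde d.+1 (\row_(i < d.+1) s`_i).
have Vunit : V \in unitmx.
  rewrite unitmxE unitfE det_Vandermonde.
  apply/prodf_neq0 => i _; apply/prodf_neq0 => j ij.
  rewrite !mxE subr_eq0 nth_uniq ?gtn_eqF //; exact: leq_trans ds.
pose w := invmx V *m delta_mx ord_max (ord0 : 'I_1).
exists (fun i => w (inord i) ord0) => j jd.
have /matrixP/(_ (inord j) ord0) : V *m w = delta_mx ord_max ord0.
  by rewrite mulmxA mulmxV // mul1mx.
rewrite !mxE eqxx andbT -val_eqE /= inordK // => <-.
by apply: eq_bigr => i _; rewrite !mxE inordK // inord_val mulrC.
Qed.

Section GridFunctional.
Variables (F : fieldType) (I : eqType) (Z : finType) (A : I -> Z -> F).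
(* For each z, W z weights the points t z so that the weighted sum extracts the
   coefficient of x ^ eta z from polynomials of degree at most eta z. *)
Variables (D : nat) (W t : Z -> 'I_D -> F) (eta : Z -> nat).
Hypothesis Wt : forall z j, (j <= eta z)%N ->
  \sum_i W z i * t z i ^+ j = (j == eta z)%:R.

(** The functional applied to the monomial with exponents [alpha] times the linear forms of [rs]. *)
Let Lam (alpha : Z -> nat) (rs : seq I) : F :=
  \sum_(x : {ffun Z -> 'I_D}) (\prod_z (W z (x z) * t z (x z) ^+ alpha z)) *
    \prod_(r <- rs) \sum_z A r z * t z (x z).

Let incr (alpha : Z -> nat) (z : Z) : Z -> nat := fun y => (alpha y + (y == z))%N.

Let Lam_nil alpha : Lam alpha [::] = \prod_z \sum_i W z i * t z i ^+ alpha z.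
Proof.
by rewrite bigA_distr_bigA; apply: eq_bigr => x _; rewrite big_nil mulr1.
Qed.

Let Lam_cons alpha r rs :
  Lam alpha (r :: rs) = \sum_z A r z * Lam (incr alpha z) rs.
Proof.
under [RHS]eq_bigr do rewrite mulr_sumr.
rewrite exchange_big; apply: eq_bigr => x _ /=.
rewrite big_cons mulrA [_ * \sum_z _]mulrC !mulr_suml; apply: eq_bigr => z _.
rewrite -!mulrA; congr (_ * _); rewrite mulrA; congr (_ * _).
rewrite [in RHS](bigD1 z) //= /incr eqxx addn1 exprS.
rewrite (bigD1 z) //= !mulrA [t z _ * _]mulrC; congr (_ * _).
by apply: eq_bigr => y /negPf ->; rewrite addn0.
Qed.

(* In total degree sum eta, a monomial other than prod_z x_z ^ eta z has some
   exponent below eta z, hence is killed by Lam. *)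
Let Lam_eq0 alpha rs : (size rs < \sum_z (eta z - alpha z))%N -> Lam alpha rs = 0.
Proof.
elim: rs alpha => [|r rs IH] alpha /= lt.
  have [z zlt] : exists z, (alpha z < eta z)%N.
    apply/existsP; apply: contraLR lt => /existsPn ge.
    by rewrite -leqNgt big1 // => z _; apply/eqP; rewrite subn_eq0 leqNgt ge.
  by rewrite Lam_nil (bigD1 z) //= Wt 1?ltnW // ltn_eqF // mul0r.
rewrite Lam_cons big1 // => z _; rewrite IH ?mulr0 // -ltnS.
apply: leq_trans lt _; rewrite (bigD1 z) //= [in leqRHS](bigD1 z) //=.
rewrite /incr eqxx addn1 -addSn; apply: leq_add.
  by rewrite subnS; case: (_ - _)%N.
by apply: leq_sum => y /negPf ->; rewrite addn0.
Qed.

(** The permanent counts each choice of one variable per row once for every ordering of equal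
    columns, hence the factorials. [alpha] collects the variables chosen in earlier rows. *)
Let per_Lam alpha rs cs : size rs = size cs ->
  (forall z, count_mem z cs + alpha z = eta z)%N ->
  per A rs cs = (\prod_z (count_mem z cs)`!)%:R * Lam alpha rs.
Proof.
elim: rs cs alpha => [|r rs IH] [|c cs] alpha //.
  move=> _ eq_eta; rewrite big1 // mul1r Lam_nil big1 // => z _.
  by rewrite Wt -eq_eta ?eqxx.
move: (c :: cs) => {c} {}cs /= szE eq_eta.
rewrite Lam_cons mulr_sumr; apply: eq_bigr => z _.
rewrite mulrCA -mulrnAr; congr (_ * _).
have [zcs|zcs] := boolP (z \in cs); last first.
  (* The exponent of [z] is already [eta z]; raising it further leaves the remaining rows one short
     of the exponents still missing. *)
  rewrite (count_memPn zcs) mulr0n Lam_eq0 ?mulr0 //.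
  rewrite -[X in (X <= _)%N]/((size rs).+1) szE size_count_mem.
  apply: leq_sum => y _; rewrite -eq_eta /incr.
  have [->|_] := eqVneq y z; first by rewrite (count_memPn zcs).
  by rewrite addn0 addnK.
have : (0 < count_mem z cs)%N by rewrite -has_count has_pred1.
case cz: (count_mem z cs) => [|n] // _.
rewrite (IH _ (incr alpha z)); last 2 first.
- by rewrite size_rem // -szE.
- move=> y; rewrite -eq_eta /incr count_rem zcs /= [z == y]eq_sym.
  have [->|_] := eqVneq y z; last by rewrite subn0 addn0.
  by rewrite cz subn1 addn1 addnS.
rewrite -mulr_natl mulrA -natrM; congr (_%:R * _).
rewrite (bigD1 z) //= [in RHS](bigD1 z) //= mulnA; congr (_ * _)%N.
  by rewrite count_rem zcs /= eqxx cz subn1 factS.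
apply: eq_bigr => y /negPf yz.
by rewrite count_rem /= [z == y]eq_sym yz andbF subn0.
Qed.

Lemma per_neq0_points rs cs : size rs = size cs ->
  (forall z, count_mem z cs = eta z) -> per A rs cs != 0 ->
  exists x : {ffun Z -> 'I_D}, (forall z, W z (x z) != 0) /\
    {in rs, forall r, \sum_z A r z * t z (x z) != 0}.
Proof.
move=> sz eq_eta; rewrite (@per_Lam (fun=> 0%N)) // => [|z]; last by rewrite addn0.
rewrite mulf_eq0 negb_or => /andP[_ Lam_neq0].
have [x] : exists x : {ffun Z -> 'I_D},
    (\prod_z (W z (x z) * t z (x z) ^+ 0)) *
    \prod_(r <- rs) \sum_z A r z * t z (x z) != 0.
  apply/existsP; apply: contraNT Lam_neq0 => /existsPn x0.
  by apply/eqP/big1 => x _; apply/eqP; rewrite -[_ == _]negbK.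
rewrite mulf_eq0 negb_or !prodf_seq_neq0 => /andP[/allP Wx /allP rx].
exists x; split=> [z|r rrs]; last exact: rx r rrs.
by have := Wx z (mem_index_enum z); rewrite mulr1.
Qed.

End GridFunctional.

Lemma per_size (F : fieldType) (I : eqType) (Z : finType) (A : I -> Z -> F) rs cs :
  per A rs cs != 0 -> size rs = size cs.
Proof.
elim: rs cs => [|r rs IH] [|c cs] //=; rewrite ?eqxx //.
  by rewrite big1 ?eqxx // => z _; rewrite mulr0n.
move=> nz; have [z] : exists z, 
  A r z * per A rs (if c == z then cs else c :: rem z cs) *+
   ((c == z) + count_mem z cs) != 0.
  apply/existsP; apply: contraNT nz => /existsPn x0.
  by apply/eqP/big1 => x _; apply/eqP; rewrite -[_ == _]negbK.
case: (eqVneq c z) => [_|cz]; last rewrite add0n.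
  by case: (eqVneq (per A rs cs) 0) => [->|/IH ->]; rewrite ?mulr0 ?mul0rn ?eqxx.
have [zcs|/count_memPn ->] := boolP (z \in cs); last by rewrite mulr0n eqxx.
case: (eqVneq (per A rs (c :: rem z cs)) 0) => [->|/IH ->].
  by rewrite mulr0 mul0rn eqxx.
by rewrite /= size_rem // prednK //; case: (cs) zcs.
Qed.

Theorem per_nullstellensatz (F : fieldType) (I : eqType) (Z : finType)
    (A : I -> Z -> F) (L : Z -> seq F) rs cs :
  (forall z, uniq (L z)) -> (forall z, (count_mem z cs < size (L z))%N) ->
  per A rs cs != 0 ->
  exists x : Z -> F, (forall z, x z \in L z) /\
    {in rs, forall r, \sum_z A r z * x z != 0}.
Proof.
move=> L_uniq cs_lt nz.
have [w wP] := fin_all_exists (fun z => ex_moment_weights (L_uniq z) (cs_lt z)).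
(* One index range serves all [z]; indices past [count_mem z cs] get weight 0, so a nonzero weight
   certifies a valid index into [L z]. *)
pose D := (size cs).+1.
pose W z (i : 'I_D) := if (i < (count_mem z cs).+1)%N then w z i else 0.
have [|x [Wx rx]] := @per_neq0_points _ _ _ A D W (fun z i => (L z)`_i)
  (fun z => count_mem z cs) _ rs cs (per_size nz) (fun=> erefl) nz.
  move=> z j jz; rewrite -wP // (big_ord_widen D (fun i => w z i * (L z)`_i ^+ j)).
    rewrite [RHS]big_mkcond; apply: eq_bigr => i _; rewrite /W.
    by case: ifP => // _; rewrite mul0r.
  by rewrite ltnS count_size.
exists (fun z => (L z)`_(x z)); split=> // z.
apply: mem_nth; move: (Wx z); rewrite /W.
by case: ifP => [lt _|_]; [exact: leq_trans lt (cs_lt z) | rewrite eqxx].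
Qed.

(** * Choosing columns with nonzero permanent *)

Section WeightColumns.
Variables (V : finType) (adj : rel V).

(* The coefficient of the weight of z in s(r.1) - s(r.2). All pairs count as
   edges; the weight of a pair outside [edges] will be 0. *)
Definition sum_coef (r : V * V) (z : V + V * V) : rat :=
  let vertex_coef w := (w == r.1)%:R - (w == r.2)%:R in
  match z with inl w => vertex_coef w | inr (a, b) => vertex_coef a + vertex_coef b end.

(** Edges point from the earlier vertex to the later one, so adding [v] puts its rows in front, as
    in [per_block]. *)
Fixpoint edges (vs : seq V) : seq (V * V) :=
  if vs is v :: vs' then [seq (v, u) | u <- vs' & adj v u] ++ edges vs' else [::].

Lemma mem_edges vs a b : (a, b) \in edges vs -> [/\ a \in vs, b \in vs & adj a b].
Proof.
elim: vs => [|v vs IH] //=; rewrite mem_cat => /orP[/mapP[u]|/IH[avs bvs ab]].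
  rewrite mem_filter => /andP[vu uvs] [-> ->].
  by rewrite !inE eqxx uvs orbT.
by rewrite !inE avs bvs !orbT.
Qed.

Lemma edges_total vs a b : symmetric adj -> a \in vs -> b \in vs -> a != b -> adj a b ->
  ((a, b) \in edges vs) || ((b, a) \in edges vs).
Proof.
move=> adj_sym; elim: vs => [|v vs IH] //=.
rewrite !inE !mem_cat => /orP[/eqP ->|avs] /orP[/eqP ->|bvs]; rewrite ?eqxx //.
- by move=> _ vb; rewrite map_f // mem_filter vb.
- by rewrite adj_sym => _ va; rewrite [X in _ || (X || _)]map_f ?orbT // mem_filter va.
by move=> ab adj_ab; have /orP[->|->] := IH avs bvs ab adj_ab; rewrite !orbT.
Qed.

(** The edge column splits into those of [v] and [u]; the term with an extra copy of [v] vanishes,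
    as too few rows are nonzero at [v]. Finished columns accumulate in [cs0]. *)
Lemma per_replace_vertices R v (N : seq V) k cs0 cs :
  (count (fun r => sum_coef r (inl v) != 0%R) R <= k)%N ->
  (k <= count_mem (inl v) cs0)%N ->
  per sum_coef R (cs0 ++ [seq if z is inl u then
      if u \in N then inr (v, u) else z else z | z <- cs]) =
  per sum_coef R (cs0 ++ cs).
Proof.
move=> Rk; elim: cs cs0 => [|z cs IH] cs0 kcs0 //=.
have mvE c s : per sum_coef R (cs0 ++ c :: s) = per sum_coef R (c :: cs0 ++ s).
  by apply: per_perm; rewrite perm_sym -cat1s perm_catCA.
rewrite !mvE -!cat_cons.
case: z => [u|p]; last by rewrite IH // (leq_trans kcs0) // leq_addl.
case: ifP => _; last by rewrite IH // (leq_trans kcs0) // leq_addl.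
rewrite !cat_cons (@per_consD _ _ _ _ _ (inl v) (inl u)) //.
rewrite [X in X + _](@per_eq0 _ _ _ _ (inl v)) ?add0r /=; last first.
  rewrite eqxx count_cat; apply: leq_ltn_trans Rk _.
  by rewrite add1n ltnS (leq_trans kcs0) // leq_addr.
by rewrite -!cat_cons IH // (leq_trans kcs0) // leq_addl.
Qed.

(** For each [u] in [N], one copy of [v] is the edge column minus the column of [u]; the two
    resulting permanents cannot both vanish. *)
Lemma per_expand_vertex R v (N : seq V) cs :
  per sum_coef R (nseq (size N) (inl v) ++ cs) != 0 ->
  exists cs', [/\ per sum_coef R (cs' ++ cs) != 0,
    forall u, (count_mem (inl u) cs' <= count_mem u N)%N &
    forall p, (count_mem (inr p) cs' <= count_mem p [seq (v, u) | u <- N])%N].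
Proof.
elim: N cs => [|u N IH] cs nz; first by exists [::].
have [c [cE nzc]] : exists c, (c = inl u \/ c = inr (v, u)) /\
    per sum_coef R (nseq (size N) (inl v) ++ c :: cs) != 0.
  have mvE c : per sum_coef R (nseq (size N) (inl v) ++ c :: cs) =
      per sum_coef R (c :: nseq (size N) (inl v) ++ cs).
    by apply: per_perm; rewrite perm_sym -cat1s perm_catCA.
  have := @per_consD _ _ _ sum_coef (inr (v, u)) (inl v) (inl u) R
    (nseq (size N) (inl v) ++ cs) (fun=> erefl).
  have [z0|nzu] := eqVneq (per sum_coef R (inl u :: nseq (size N) (inl v) ++ cs)) 0.
    by rewrite z0 addr0 => E; exists (inr (v, u)); rewrite mvE E; split; [right|].
  by move=> _; exists (inl u); rewrite mvE; split; [left|].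
have [cs' [nz' vcs' ecs']] := IH _ nzc.
exists (c :: cs'); split => [|w|p] /=.
- by rewrite -(@per_perm _ _ _ _ _ (cs' ++ c :: cs)) // -[c :: cs]cat1s perm_catCA.
- by apply: leq_add => //; case: cE => ->.
- by apply: leq_add => //; case: cE => ->.
Qed.

Theorem ex_columns vs : uniq vs -> exists cs : seq (V + V * V),
  [/\ per sum_coef (edges vs) cs != 0,
    forall v, (count_mem (inl v) cs <= (v \in vs))%N &
    forall p, (count_mem (inr p) cs <= (p \in edges vs).*2)%N].
Proof.
elim: vs => [|v vs IH] /=; first by exists [::].
case/andP=> vvs vs_uniq; have [cs [nz vcs ecs]] := IH vs_uniq.
set N := [seq u <- vs | adj v u].
set new := [seq (v, u) | u <- N].
have vN : v \notin N by rewrite mem_filter (negPf vvs) andbF.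
have new_edge r : r \in new -> r.1 = v /\ r.2 \in N by case/mapP=> u uN ->.
have old_edge r : r \in edges vs -> (v == r.1 = false) * (v == r.2 = false).
  case: r => a b /mem_edges[avs bvs _] /=.
  by split; apply/negbTE; apply: contraNneq vvs => ->.
have szN : size new = size N by rewrite size_map.
have coef_new : {in new, forall r, sum_coef r (inl v) = 1}.
  move=> r /new_edge[rv rN]; rewrite /= rv eqxx.
  case: (eqVneq v r.2) => [vr|_]; last by rewrite subr0.
  by rewrite vr rN in vN.
have coef_old : {in edges vs, forall r, sum_coef r (inl v) = 0}.
  by move=> r /old_edge /= [-> ->]; rewrite subr0.
have v_cs : inl v \notin cs.
  by rewrite -has_pred1 has_count -leqNgt (leq_trans (vcs v)) // (negPf vvs).
(* Over the rationals the factorial from [per_block] is nonzero. *)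
have fact_neq0 : (size new)`!%:R != 0 :> rat by rewrite pnatr_eq0 -lt0n fact_gt0.
have := mulf_neq0 fact_neq0 nz.
rewrite -(@per_block _ _ _ _ (inl v)) // szN.
rewrite -(@per_replace_vertices _ v N (size N)); last 2 first.
- rewrite count_cat [X in (_ + X)%N](@eq_in_count _ _ pred0); last first.
    by move=> r /coef_old ->; rewrite eqxx.
  by rewrite count_pred0 addn0 (leq_trans (count_size _ _)) ?szN.
- by rewrite count_nseq /= eqxx mul1n.
case/per_expand_vertex=> cs' [nz' vcs' ecs'].
eexists; split; first exact: nz'.
  move=> w; rewrite count_cat count_map inE.
  have [wN|wN] := boolP (w \in N).
    (* Every old copy of a neighbour [w] became an edge, so only the expansion contributes. *)
    rewrite [X in (_ + X)%N](@eq_count _ _ pred0) ?count_pred0 ?addn0; last first.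
      move=> [u|p] //=; case: ifPn => // uN.
      by apply/eqP => -[uw]; rewrite uw wN in uN.
    move: (wN); rewrite mem_filter => /andP[_ ->]; rewrite orbT.
    rewrite (leq_trans (vcs' w)) // count_uniq_mem ?leq_b1 //.
    exact: filter_uniq.
  (* For other [w] neither operation adds a copy. *)
  have := vcs' w; rewrite (count_memPn wN) leqn0 => /eqP ->.
  rewrite add0n (leq_trans (sub_count (a2 := pred1 (inl w)) _ cs)) //.
    by move=> [u|p] //=; case: ifP.
  by apply: leq_trans (vcs w) _; case: (w \in vs); rewrite ?orbT.
move=> p; rewrite count_cat count_map.
have uniq_new : uniq new by rewrite map_inj_uniq ?filter_uniq // => a b [].
have := ecs' p; rewrite (count_uniq_mem p uniq_new).
rewrite mem_cat; case: (boolP (p \in new)) => [pnew|pnew]; last first.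
  rewrite leqn0 orFb => /eqP ->; rewrite add0n.
  apply: leq_trans (ecs p); apply: sub_count => -[u|q] //=.
  by case: ifP => // uN /eqP[up]; rewrite -up map_f in pnew.
(* A new edge arises at most once in the expansion, and at most once by replacing its end [p.2],
   which [cs] contains at most once. *)
move=> le1; apply: leq_trans (leq_add le1 _) (leqnn 2).
have [pv pN] := new_edge _ pnew.
have pcs : count_mem (inr p) cs = 0%N.
  apply/eqP; rewrite -leqn0 (leq_trans (ecs p)) //.
  by have [/old_edge[]|//] := boolP (p \in edges vs); rewrite pv eqxx.
apply: leq_trans (leq_trans (vcs p.2) (leq_b1 _)).
rewrite -[leqRHS]addn0 -pcs -count_predUI.
apply: leq_trans (leq_addr _ _); apply: sub_count => -[u|q] //=.
by case: ifP => // uN /eqP[<-] /=; rewrite eqxx.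
Qed.

End WeightColumns.

(** * Weightings of finite graphs *)

Section FiniteGraphs.
Variables (V : finType) (adj : rel V).
Hypotheses (adj_sym : symmetric adj) (adj_irr : irreflexive adj).
Variables (Lv : V -> seq nat) (Le : V -> V -> seq nat).
Hypotheses (Lv_uniq : forall v, uniq (Lv v)) (Lv_size : forall v, (1 < size (Lv v))%N).
Hypothesis Le_sym : forall u v, adj u v -> Le u v = Le v u.
Hypothesis Le_uniq : forall u v, adj u v -> uniq (Le u v).
Hypothesis Le_size : forall u v, adj u v -> (2 < size (Le u v))%N.

(** Double counting: the weight of a pair enters [s] at both ends. Summing over both orientations
    makes [s] independent of how an edge is listed. *)
Lemma sum_coefE (r : V * V) (x : V + V * V -> rat) (s : V -> rat) :
  (forall a, s a = x (inl a) + \sum_b (x (inr (a, b)) + x (inr (b, a)))) ->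
  \sum_z sum_coef r z * x z = s r.1 - s r.2.
Proof.
move=> sE; pose c a : rat := (a == r.1)%:R - (a == r.2)%:R.
have c_sum f : \sum_a c a * f a = f r.1 - f r.2.
  have delta (b : V) : \sum_a (a == b)%:R * f a = f b.
    rewrite (bigD1 b) //= eqxx mul1r big1 ?addr0 // => a /negPf ->.
    by rewrite mul0r.
  by rewrite -!delta -sumrB; apply: eq_bigr => a _; rewrite mulrBl.
rewrite -c_sum big_sumType /=.
under [RHS]eq_bigr do rewrite sE mulrDr big_split mulrDr /=.
rewrite !big_split; congr (_ + _).
under [in RHS]eq_bigr do rewrite mulr_sumr.
under [X in _ = _ + X]eq_bigr do rewrite mulr_sumr.
rewrite [X in _ = _ + X]exchange_big !pair_bigA -big_split /=.
by apply: eq_bigr => -[a b] _ /=; rewrite mulrDl.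
Qed.

Lemma edges_asym vs a b : uniq vs -> (a, b) \in edges adj vs -> (b, a) \notin edges adj vs.
Proof.
elim: vs => [|v vs IH] //= /andP[vvs vs_uniq].
have newE c d : ((c, d) \in [seq (v, u) | u <- vs & adj v u]) -> c = v /\ d \in vs.
  by case/mapP=> u; rewrite mem_filter => /andP[_ uvs] [-> ->].
rewrite !mem_cat negb_or => /orP[/newE[-> bvs]|ab].
  apply/andP; split; first by apply: contra vvs => /newE[<-].
  by apply: contra vvs => /mem_edges[].
rewrite IH // andbT; apply: contra vvs => /newE[<- _].
by case/mem_edges: ab.
Qed.

Theorem finite_weighting : exists (wv : V -> nat) (we : V -> V -> nat),
  [/\ forall v, wv v \in Lv v,
    forall u v, adj u v -> we u v = we v u,
    forall u v, adj u v -> we u v \in Le u v &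
    forall u v, adj u v ->
      (wv u + \sum_(w | adj u w) we u w != wv v + \sum_(w | adj v w) we v w)%N].
Proof.
pose E := edges adj (enum V).
have [cs [nz vcs ecs]] := ex_columns adj (enum_uniq V).
(* A pair outside [E] never occurs as a column, so the single value 0 is a long enough list for
   it. *)
pose L z := match z with inl v => Lv v
  | inr p => if p \in E then Le p.1 p.2 else [:: 0%N] end.
have adjE p : p \in E -> adj p.1 p.2 by case: p => a b /mem_edges[].
have L_uniq z : uniq (map (fun n => n%:R : rat) (L z)).
  rewrite map_inj_uniq => [|m n /eqP]; last by rewrite eqr_nat => /eqP.
  by case: z => [v|p] //=; case: ifP => // /adjE /Le_uniq.
have cs_lt z : (count_mem z cs < size (map (fun n => n%:R : rat) (L z)))%N.
  rewrite size_map; case: z => [v|p] /=.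
    by apply: leq_trans (Lv_size v); rewrite ltnS (leq_trans (vcs v)) // leq_b1.
  apply: leq_ltn_trans (ecs p) _; rewrite -/E.
  by case: ifP => // /adjE /Le_size.
have [x [xL xE]] := per_nullstellensatz L_uniq cs_lt nz.
have /fin_all_exists[n nE] z : exists n, n \in L z /\ x z = n%:R.
  by have /mapP[n nL xn] := xL z; exists n.
have n_notin p : p \notin E -> n (inr p) = 0%N.
  by move=> pE; have [+ _] := nE (inr p); rewrite /= (negPf pE) inE => /eqP.
have n_in p : p \in E -> n (inr p) \in Le p.1 p.2.
  by move=> pE; have [+ _] := nE (inr p); rewrite /= pE.
(* Only one orientation of an edge lies in [E]; the other summand of [we] is 0. *)
pose wv v := n (inl v); pose we u v := (n (inr (u, v)) + n (inr (v, u)))%N.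
have total u v : adj u v -> ((u, v) \in E) || ((v, u) \in E).
  move=> uv; apply: edges_total => //; rewrite ?mem_enum //.
  by apply: contraTneq uv => ->; rewrite adj_irr.
pose s v := (wv v + \sum_(w | adj v w) we v w)%N.
have sE a : (s a)%:R = x (inl a) + \sum_b (x (inr (a, b)) + x (inr (b, a))).
  rewrite natrD natr_sum; have [_ ->] := nE (inl a); congr (_ + _).
  rewrite big_mkcond; apply: eq_bigr => b _.
  have [[_ ->] [_ ->]] := (nE (inr (a, b)), nE (inr (b, a))).
  case: ifPn => [_|ab]; first by rewrite natrD.
  by rewrite !n_notin ?addr0 //; apply: contra ab => /adjE //=; rewrite adj_sym.
have s_neq r : r \in E -> s r.1 != s r.2.
  by move=> /xE; rewrite (sum_coefE _ sE) subr_eq0 eqr_nat.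
exists wv, we; split=> [v|u v uv|u v uv|u v uv].
- by have [] := nE (inl v).
- by rewrite /we addnC.
- rewrite /we; have /orP[uvE|vuE] := total _ _ uv.
    by rewrite [X in (_ + X)%N]n_notin ?addn0 ?(n_in (u, v)) // edges_asym ?enum_uniq.
  by rewrite [X in (X + _)%N]n_notin ?(Le_sym uv) ?(n_in (v, u)) // edges_asym ?enum_uniq.
- by have /orP[/s_neq|/s_neq] := total _ _ uv; rewrite // eq_sym.
Qed.

End FiniteGraphs.

(** * Translation of list notions *)

Lemma In_mem (T : eqType) (x : T) (s : seq T) : List.In x s <-> x \in s.
Proof.
elim: s => [|y s IH] //=; rewrite inE; split.
  by case=> [->|/IH ->]; rewrite ?eqxx ?orbT.
by case/orP=> [/eqP ->|/IH]; [left|right].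
Qed.

Lemma NoDup_uniq (T : eqType) (s : seq T) : List.NoDup s <-> uniq s.
Proof.
elim: s => [|y s IH] /=; first by split=> // _; apply: List.NoDup_nil.
split; first by case/List.NoDup_cons_iff => /In_mem/negP -> /IH.
by case/andP=> /negP ys /IH us; apply: List.NoDup_cons => // /In_mem.
Qed.

Lemma fold_right_sum (T : Type) (f : T -> nat) (s : seq T) :
  List.fold_right (fun w acc => f w + acc)%N 0%N s = (\sum_(w <- s) f w)%N.
Proof. by elim: s => [|w s IH] /=; rewrite ?big_nil ?big_cons ?IH. Qed.

(** * Infinite graphs by compactness *)

Section InfiniteGraphs.
Variables (V : choiceType) (adj : rel V).
Hypotheses (adj_sym : symmetric adj) (adj_irr : irreflexive adj).
Variables (Lv : V -> seq nat) (Le : V -> V -> seq nat).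
Hypotheses (Lv_uniq : forall v, uniq (Lv v)) (Lv_size : forall v, (1 < size (Lv v))%N).
Hypothesis Le_sym : forall u v, adj u v -> Le u v = Le v u.
Hypothesis Le_uniq : forall u v, adj u v -> uniq (Le u v).
Hypothesis Le_size : forall u v, adj u v -> (2 < size (Le u v))%N.

Definition from_lists (w : (V -> nat) * (V -> V -> nat)) :=
  [/\ forall v, w.1 v \in Lv v, forall u v, adj u v -> w.2 u v = w.2 v u &
      forall u v, adj u v -> w.2 u v \in Le u v].

(** A vertex whose whole neighbourhood lies in [W] has the same weighted degree in the induced graph
    on [W], to which the finite case applies. *)
Lemma local_weighting (W : seq V) : exists w, from_lists w /\
  forall u v lu lv, adj u v -> u \in W -> v \in W ->
    uniq lu -> uniq lv -> lu =i adj u -> lv =i adj v ->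
    {subset lu <= W} -> {subset lv <= W} ->
    (w.1 u + \sum_(x <- lu) w.2 u x != w.1 v + \sum_(x <- lv) w.2 v x)%N.
Proof.
pose T := seq_sub W; pose adjT : rel T := fun a b => adj (val a) (val b).
have [wvT [weT [wvTL weTC weTL wT]]] := @finite_weighting T adjT
  (fun _ _ => adj_sym _ _) (fun _ => adj_irr _)
  (fun a => Lv (val a)) (fun a b => Le (val a) (val b))
  (fun _ => Lv_uniq _) (fun _ => Lv_size _)
  (fun _ _ => @Le_sym _ _) (fun _ _ => @Le_uniq _ _) (fun _ _ => @Le_size _ _).
(* Outside [W] the first list entry is used; [Le_sym] keeps this symmetric on edges. *)
pose wv v := if insub v is Some a then wvT a else head 0%N (Lv v).
pose we u v := match insub u, insub v with
  | Some a, Some b => weT a b | _, _ => head 0%N (Le u v) end.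
have mem_head s : (0 < size s)%N -> head 0%N s \in s.
  by case: s => // x s _; rewrite inE eqxx.
exists (wv, we); split.
  split=> [v|u v uv|u v uv] /=.
  - rewrite /wv; case: insubP => [a _ <- //|_].
    exact/mem_head/ltnW/Lv_size.
  - rewrite /we; case: insubP uv => [a _ <-|_]; case: insubP => [b _ <-|_] uv;
      by rewrite ?(Le_sym uv) // weTC.
  have uvL : head 0%N (Le u v) \in Le u v.
    by apply/mem_head/ltnW/ltnW/Le_size.
  rewrite /we; case: insubP uv uvL => [a _ <-|_] //.
  by case: insubP => [b _ <-|_] // ab _; apply: weTL.
have sumT (a : T) l : uniq l -> l =i adj (val a) -> {subset l <= W} ->
    (\sum_(x <- l) we (val a) x = \sum_(b | adjT a b) weT a b)%N.
  move=> l_uniq lE lW.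
  rewrite (perm_big [seq val b | b <- enum [pred b | adjT a b]]) /=; last first.
    apply: uniq_perm => //; first by rewrite (map_inj_uniq val_inj) enum_uniq.
    move=> x; apply/idP/mapP => [xl|[b]].
      by exists (SeqSub (lW _ xl)); rewrite // mem_enum inE -[adjT _ _]lE.
    by rewrite mem_enum inE => ab ->; rewrite lE.
  rewrite big_map big_enum; apply: eq_bigr => b _.
  by rewrite /we !valK.
move=> u v lu lv uv uW vW lu_uniq lv_uniq luE lvE luW lvW /=.
pose a : T := SeqSub uW; pose b : T := SeqSub vW.
have := wT a b uv; rewrite -(sumT a lu) // -(sumT b lv) //.
by rewrite /wv -[u]/(val a) -[v]/(val b) !valK.
Qed.

(** An ultrafilter selects one cell of a finite partition; this value is the limit of [f] along
    [G]. *)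
Lemma ultra_value (T : Type) (G : set_system T) (f : T -> nat) (s : seq nat) :
  UltraFilter G -> (forall t, f t \in s) -> exists n, G [set t | f t = n]%classic.
Proof.
move=> G_ultra fs; have : G [set t | f t \in s]%classic by apply: filterE.
elim: s {fs} => [|n s IH].
  by move=> G0; have [t] := filter_ex G0.
have [Gn _|Gn Gs] := in_ultra_setVsetC [set t | f t = n]%classic G_ultra.
  by exists n.
apply: IH; apply: filterS2 Gn Gs => t /= /eqP/negPf.
by rewrite inE => ->.
Qed.

Lemma filter_all (T : Type) (X : eqType) (G : set_system T) (P : X -> T -> Prop) (s : seq X) :
  Filter G -> (forall x, x \in s -> G (P x)) -> G [set t | forall x, x \in s -> P x t]%classic.
Proof.
move=> G_filter; elim: s => [|y s IH] GP; first exact: filterE.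
have Gy := GP y (mem_head _ _).
have Gs : G [set t | forall x, x \in s -> P x t]%classic.
  by apply: IH => x xs; apply: GP; rewrite inE xs orbT.
apply: filterS2 Gy Gs => t Pt Ps x.
by rewrite inE => /orP[/eqP ->|/Ps].
Qed.

Theorem infinite_weighting : exists w, from_lists w /\
  forall u v lu lv, adj u v ->
    uniq lu -> uniq lv -> lu =i adj u -> lv =i adj v ->
    (w.1 u + \sum_(x <- lu) w.2 u x != w.1 v + \sum_(x <- lv) w.2 v x)%N.
Proof.
have [w wP] := choice local_weighting.
pose F : set_system (seq V) :=
  [set P | exists W0 : seq V, forall W : seq V, {subset W0 <= W} -> P W]%classic.
have F_proper : ProperFilter F.
  apply: Build_ProperFilter; last first.
    split; first by exists [::].
      move=> P Q [W1 PW] [W2 QW]; exists (W1 ++ W2) => W sW; split.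
        by apply: PW => x xW; apply: sW; rewrite mem_cat xW.
      by apply: QW => x xW; apply: sW; rewrite mem_cat xW orbT.
    by move=> P Q PQ [W1 PW]; exists W1 => W /PW /PQ.
  by case=> W1 /(_ W1); apply.
have [G [G_ultra FG]] := ultraFilterLemma F_proper.
have /choice[wv wvP] v : exists n, G [set W | (w W).1 v = n]%classic.
  apply: (@ultra_value _ _ _ (Lv v)) => W.
  by have [[+ _ _] _] := wP W; apply.
(* Off the edges no finite list confines the values, so 0 is taken there instead of a limit. *)
have /choice[we weP] (p : V * V) : exists n,
    adj p.1 p.2 -> G [set W | (w W).2 p.1 p.2 = n]%classic.
  have [uv|] := boolP (adj p.1 p.2); last by exists 0%N.
  have [|n Gn] := @ultra_value _ G (fun W => (w W).2 p.1 p.2) (Le p.1 p.2) G_ultra.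
    by move=> W; have [[_ _ +] _] := wP W; apply.
  by exists n.
exists (wv, fun u v => we (u, v)); split.
  split=> [v|u v uv|u v uv] /=.
  - have [W <-] := filter_ex (wvP v).
    by have [[+ _ _] _] := wP W; apply.
  - have vu : adj v u by rewrite adj_sym.
    have [W [<- <-]] := filter_ex (filterI (weP (u, v) uv) (weP (v, u) vu)).
    by have [[_ + _] _] := wP W; apply.
  have [W <-] := filter_ex (weP (u, v) uv).
  by have [[_ _ +] _] := wP W; apply.
move=> u v lu lv uv lu_uniq lv_uniq luE lvE /=.
have G_sub : G [set W | {subset u :: v :: lu ++ lv <= W}]%classic.
  by apply: FG; exists (u :: v :: lu ++ lv).
have G_star a (l : seq V) : l =i adj a ->
    G [set W | forall x, x \in l -> (w W).2 a x = we (a, x)]%classic.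
  move=> lE; apply: filter_all => x xl.
  have ax : adj a x by rewrite -[adj _ _]lE.
  exact: weP (a, x) ax.
(* Finitely many sets of [G] meet: some [W] contains both closed neighbourhoods, and its weighting
   agrees with the limit on every weight in the two sums. *)
have [W [[sW [wuW wvW]] [luW lvW]]] := filter_ex (filterI
  (filterI G_sub (filterI (wvP u) (wvP v))) (filterI (G_star u lu luE) (G_star v lv lvE))).
have uW : u \in W by apply: sW; rewrite mem_head.
have vW : v \in W by apply: sW; rewrite !inE eqxx orbT.
have lu_sub : {subset lu <= W}.
  by move=> x xl; apply: sW; rewrite !inE mem_cat xl !orbT.
have lv_sub : {subset lv <= W}.
  by move=> x xl; apply: sW; rewrite !inE mem_cat xl !orbT.
have [_ w_neq] := wP W.
have := w_neq u v lu lv uv uW vW lu_uniq lv_uniq luE lvE lu_sub lv_sub.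
by rewrite wuW wvW (eq_big_seq _ luW) (eq_big_seq _ lvW).
Qed.

End InfiniteGraphs.

(** * Arbitrary vertex types and infinite degrees *)

Theorem theorem4 (V : Type) (adj : V -> V -> Prop) (Hg : simple_graph adj)
  (Lv : V -> list nat) (Le : V -> V -> list nat)
  (HLv : forall v, is_list (Lv v) /\ (2 <= length (Lv v))%coq_nat)
  (HLe_sym : forall u v, adj u v -> Le u v = Le v u)
  (HLe : forall u v, adj u v -> is_list (Le u v) /\ (3 <= length (Le u v))%coq_nat) :
  exists (wv : V -> nat) (we : V -> V -> nat), L_weighting adj Lv Le wv we.
Proof.
have [adj_sym adj_irr] := Hg.
pose T : choiceType := {classic V}; pose e : rel T := fun u v => `[< adj u v >].
have eP u v : e u v -> adj u v by move/asboolP.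
have e_sym : symmetric e by move=> u v; apply: asbool_equiv_eq; split; apply: adj_sym.
have e_irr : irreflexive e by move=> v; apply/negbTE/asboolP/adj_irr.
have Lv_uniq v : uniq (Lv v) by have [[/NoDup_uniq]] := HLv v.
have Lv_size v : (1 < size (Lv v))%N by have [_ /ssrnat.leP] := HLv v.
have Le_sym u v : e u v -> Le u v = Le v u by move/eP/HLe_sym.
have Le_uniq u v : e u v -> uniq (Le u v) by move=> /eP/HLe[[/NoDup_uniq]].
have Le_size u v : e u v -> (2 < size (Le u v))%N by move=> /eP/HLe[_ /ssrnat.leP].
have [[wv we] /= [[wvL weC weL] w_neq]] :=
  @infinite_weighting T e e_sym e_irr Lv Le Lv_uniq Lv_size Le_sym Le_uniq Le_size.
exists wv, we; split.
  split=> [v|]; first exact/In_mem.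
  by split=> u v /asboolP uv; [exact: weC | apply/In_mem/weL].
move=> u v uv; have [same|Nsame] := pselect (same_infinite_degree adj u v).
  by right.
(* Only the finite case of [wdeg_eq] remains; it supplies lists of both neighbourhoods. *)
left=> -[[n [[lu [lu_uniq [luE ->]]] [lv [lv_uniq [lvE]]]]]|//].
have starE a l : (forall w, adj a w <-> List.In w l) -> (l : seq T) =i e a.
  move=> lE w; apply/idP/asboolP => [/(In_mem (T := T))/lE //|/lE].
  by move/(In_mem (T := T)).
rewrite !fold_right_sum => /eqP; apply/negP.
by apply: (w_neq u v lu lv); [exact/asboolP | exact/(@NoDup_uniq T)
  | exact/(@NoDup_uniq T) | exact: starE | exact: starE].
Qed.
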